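(* Let $G$ be an abelian group and $\phi\in\mathrm{End}(G)$. Then the Pinsker subgroup $\mathbf P(G,\phi)$ of $G$ exists; that is, there exists a greatest $\phi$-invariant subgroup $P$ of $G$ such that $h(\phi\restriction_P)=0$.
   Context: A subgroup $H$ of $G$ is $\phi$-invariant if $\phi(H)\subseteq H$. For a non-empty finite subset $F$ of $G$ and an integer $n\geq 1$ put $T_n(\phi,F)=F+\phi(F)+\dots+\phi^{n-1}(F)$. The limit $H(\phi,F)=\lim_{n\to\infty}\frac{\log|T_n(\phi,F)|}{n}$ exists, and the algebraic entropy of $\phi$ is $h(\phi)=\sup_F H(\phi,F)$, where $F$ ranges over all non-empty finite subsets of $G$. The Pinsker subgroup $\mathbf P(G,\phi)$ is by definition the greatest (with respect to inclusion) $\phi$-invariant subgroup of $G$ on which the restriction of $\phi$ has zero algebraic entropy. *)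

(* Defs.v *)
From HB Require Import structures.
From mathcomp Require Import all_boot all_order all_algebra finmap.
From mathcomp Require Import all_classical all_reals all_analysis.
Import Order.TTheory GRing.Theory Num.Theory.
Import numFieldNormedType.Exports.

Set Implicit Arguments.
Unset Strict Implicit.
Unset Printing Implicit Defensive.

Local Open Scope classical_set_scope.
Local Open Scope ring_scope.

Definition fsumset (G : zmodType) (A B : {fset G}) : {fset G} :=
  [fset (a + b)%R | a in A, b in B]%fset.

(* The empty sum (n = 0) is {0}. *)
Definition trajectory (G : zmodType) (phi : {additive G -> G}) (F : {fset G})
    (n : nat) : {fset G} :=
  \big[@fsumset G/[fset 0%R]%fset]_(i < n) (iter i phi @` F)%fset.

(* The term of index 0 is a division by zero, irrelevant for the limit. *)
Definition entropy_at (R : realType) (G : zmodType) (phi : {additive G -> G})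
    (F : {fset G}) : R :=
  limn (fun n : nat => ln (#|` trajectory phi F n|%:R : R) / n%:R).

Definition algebraic_entropy (R : realType) (G : zmodType)
    (phi : {additive G -> G}) : \bar R :=
  ereal_sup [set (entropy_at R phi F)%:E | F in [set F : {fset G} | F != fset0%fset]].

(* A subgroup of G is a term of the structure [zmodClosed G]; below it is turned
   into an abelian group of its own. *)
Definition subgroup_type (G : zmodType) (P : zmodClosed G) : Type :=
  {x : G | x \in P}.

HB.instance Definition _ (G : zmodType) (P : zmodClosed G) :=
  SubChoice.on (subgroup_type P).
HB.instance Definition _ (G : zmodType) (P : zmodClosed G) :=
  [SubChoice_isSubZmodule of subgroup_type P by <:].

Definition invariant_subgroup (G : zmodType) (phi : {additive G -> G})
    (P : zmodClosed G) : Prop :=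
  forall x : G, x \in P -> phi x \in P.

Definition restriction (G : zmodType) (phi : {additive G -> G})
    (P : zmodClosed G) (invP : invariant_subgroup phi P)
    (x : subgroup_type P) : subgroup_type P :=
  exist _ (phi (val x)) (invP (val x) (valP x)).

Lemma restriction_is_zmod_morphism (G : zmodType) (phi : {additive G -> G})
    (P : zmodClosed G) (invP : invariant_subgroup phi P) :
  zmod_morphism (restriction invP).
Proof. by move=> x y; apply: val_inj; rewrite /= !raddfB. Qed.

HB.instance Definition _ (G : zmodType) (phi : {additive G -> G})
    (P : zmodClosed G) (invP : invariant_subgroup phi P) :=
  GRing.isZmodMorphism.Build (subgroup_type P) (subgroup_type P)
    (restriction invP) (restriction_is_zmod_morphism invP).

Definition is_pinsker_subgroup (R : realType) (G : zmodType)
    (phi : {additive G -> G}) (P : zmodClosed G) : Prop :=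
  (exists invP : invariant_subgroup phi P,
     algebraic_entropy R (restriction invP) = 0%E) /\
  (forall (Q : zmodClosed G) (invQ : invariant_subgroup phi Q),
     algebraic_entropy R (restriction invQ) = 0%E -> {subset Q <= P}).

(* Main.v *)
Require Import Defs.
From mathcomp Require Import all_boot all_order all_algebra.
From mathcomp Require Import all_classical all_reals all_analysis.
From HB Require Import structures.
From mathcomp Require Import finmap.

(** Write [T_n F] for the trajectory of a finite set [F], and say that [F] has
    zero growth when [ln #|T_n F| / n] tends to 0.  The Pinsker subgroup is the
    set [P] of all [x] such that [{0, x}] has zero growth.  This works because
    trajectories commute with sums of sets: [T_n (A + B) = T_n A + T_n B]
    ([trajectory_fsumset]), so that [#|T_n (A + B)| <= #|T_n A| * #|T_n B|] and
    zero growth passes from [A] and [B] to [A + B] ([zero_growth_fsumset]), hence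
    to every nonempty subset of [A + B] ([zero_growthS]).

    Since [{0, x - y}] lies in [{0, x} + {0, - y}], [P] is a subgroup; it is
    invariant under every endomorphism commuting with [phi], in particular under
    [phi] itself ([pinsker_equivariant]).  Any nonempty finite subset of [P] is
    contained in the sum of the sets [{0, x}], where [x] ranges over its elements, so it has
    zero growth ([pinsker_zero_growth]), and [phi] has zero entropy on [P].
    Conversely, if [phi] has zero entropy on an invariant subgroup [Q], then
    [{0, x}] has zero growth for each [x] in [Q], whence [Q <= P].

    This last step reads the convergence of the sequence [ln #|T_n F| / n] off the
    value of its limit, and the limit operator also has a value, possibly 0, on
    divergent sequences.  Convergence must therefore be known beforehand: it
    follows from Fekete's lemma ([cvg_subadditive_quotient]), because
    [T_(m + n) F = T_m F + phi^m (T_n F)] ([trajectoryD]) makes [ln #|T_n F|]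
    subadditive. *)

Import Order.TTheory GRing.Theory Num.Theory.
Import numFieldNormedType.Exports.

Set Implicit Arguments.
Unset Strict Implicit.
Unset Printing Implicit Defensive.

Local Open Scope classical_set_scope.
Local Open Scope ring_scope.

(** * Fekete's lemma for nonnegative subadditive sequences *)

Section Fekete.
Variables (R : realType) (a : nat -> R).
Hypothesis a_ge0 : forall n, 0 <= a n.
Hypothesis a_subadd : forall m n, a (m + n)%N <= a m + a n.

Lemma subadditive_mulnD m q r : a (q * m + r)%N <= a m *+ q + a r.
Proof.
elim: q => [|q IHq]; first by rewrite mul0n add0n mulr0n add0r.
rewrite mulSn -addnA mulrS -addrA; apply: le_trans (a_subadd _ _) _.
by rewrite lerD2l.
Qed.

(** Divide [n] by [m.+1] with quotient [q] and remainder [r]: the [q] blocks of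
    length [m.+1] cost [q * a m.+1], and [a r] is one of the terms of a sum that
    does not depend on [n]. *)
Lemma subadditive_quotient_le m n : (0 < n)%N ->
  a n / n%:R <= a m.+1 / m.+1%:R + (\sum_(r < m.+1) a r) / n%:R.
Proof.
move=> n0; have n0R : 0 < n%:R :> R by rewrite ltr0n.
rewrite ler_pdivrMr// mulrDl divfK ?gt_eqF//.
rewrite {1}(divn_eq n m.+1); apply: le_trans (subadditive_mulnD _ _ _) _.
apply: lerD; last first.
  rewrite (bigD1 (Ordinal (ltn_pmod n (ltn0Sn m))))//= lerDl.
  by apply: sumr_ge0 => i _; exact: a_ge0.
rewrite -[a _ *+ _]mulr_natr -mulrA ler_wpM2l//.
by rewrite ler_pdivlMl ?ltr0n// -natrM ler_nat mulnC leq_divM.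
Qed.

Lemma cvg_subadditive_quotient : cvgn (fun n => a n / n%:R).
Proof.
pose E := [set a n.+1 / n.+1%:R | n in [set: nat]].
have lbE : has_lbound E.
  by exists 0 => _ [n _ <-]; rewrite divr_ge0.
have infE : has_inf E by split=> //; exists (a 1%N / 1%:R); exists 0%N.
apply/cvg_ex; exists (inf E); apply/cvgrPdist_lt => e e0.
have e20 : 0 < e / 2 by rewrite divr_gt0.
have [_ [m _ <-] ltm] := inf_adherent e20 infE.
pose C := \sum_(r < m.+1) a r.
near=> n.
have n0 : (0 < n)%N by near: n; exact: nbhs_infty_ge.
have leC : C / n%:R < e / 2.
  rewrite ltr_pdivrMr ?ltr0n// -ltr_pdivrMl//.
  rewrite (@lt_le_trans _ _ ((e / 2)^-1 * C + 1)) ?ltrDl//.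
  by near: n; exact: nbhs_infty_ger.
have ge_inf : inf E <= a n / n%:R.
  by apply: ge_inf => //; exists n.-1 => //; rewrite prednK.
rewrite distrC ger0_norm ?subr_ge0// ltrBlDl.
apply: le_lt_trans (subadditive_quotient_le m n0) _.
by rewrite -/C [e in ltRHS]splitr addrA ltrD.
Unshelve. all: by end_near. Qed.

End Fekete.

(** * The commutative monoid of finite sets under sumset *)

Section Sumset.
Variable G : zmodType.
Implicit Types A B C F : {fset G}.

Lemma mem_fsumset A B a b : a \in A -> b \in B -> a + b \in fsumset A B.
Proof. by move=> Aa Bb; apply/imfset2P; exists a => //; exists b. Qed.

Lemma mem_fsumsetl A B a : a \in A -> 0 \in B -> a \in fsumset A B.
Proof. by move=> Aa B0; rewrite -(addr0 a); exact: mem_fsumset. Qed.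

Lemma mem_fsumsetr A B b : 0 \in A -> b \in B -> b \in fsumset A B.
Proof. by move=> A0 Bb; rewrite -(add0r b); exact: mem_fsumset. Qed.

Lemma fsumsetP A B x :
  reflect (exists a b, [/\ a \in A, b \in B & x = a + b]) (x \in fsumset A B).
Proof.
apply: (iffP idP) => [/imfset2P[a Aa [b Bb ->]]|[a [b [Aa Bb ->]]]].
  by exists a, b.
exact: mem_fsumset.
Qed.

Lemma fsumsetA : associative (@fsumset G).
Proof.
move=> A B C; apply/fsetP => x; apply/fsumsetP/fsumsetP.
  move=> [a [_ [Aa /fsumsetP[b [c [Bb Cc ->]]] ->]]].
  by exists (a + b), c; split; rewrite ?addrA// mem_fsumset.
move=> [_ [c [/fsumsetP[a [b [Aa Bb ->]]] Cc ->]]].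
by exists a, (b + c); split; rewrite ?addrA// mem_fsumset.
Qed.

Lemma fsumsetC : commutative (@fsumset G).
Proof.
by move=> A B; apply/fsetP => x; apply/fsumsetP/fsumsetP => -[a [b [Aa Bb ->]]];
  exists b, a; rewrite addrC.
Qed.

Lemma fsum0set : left_id [fset 0]%fset (@fsumset G).
Proof.
move=> A; apply/fsetP => x; apply/fsumsetP/idP => [[_ [a [/fset1P-> Aa ->]]]|Ax].
  by rewrite add0r.
by exists 0, x; rewrite add0r fset11.
Qed.

(** A trajectory is an iterated sumset; with this structure the general lemmas on
    iterated operators split it and distribute it over sums. *)
HB.instance Definition _ :=
  Monoid.isComLaw.Build {fset G} [fset 0]%fset (@fsumset G)
    fsumsetA fsumsetC fsum0set.

Lemma fsumsetS A A' B B' : (A `<=` A' -> B `<=` B' ->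
  fsumset A B `<=` fsumset A' B')%fset.
Proof.
move=> /fsubsetP sA /fsubsetP sB; apply/fsubsetP => _ /fsumsetP[a [b [Aa Bb ->]]].
by rewrite mem_fsumset ?sA ?sB.
Qed.

Lemma fsumset_neq0 A B :
  A != fset0 -> B != fset0 -> fsumset A B != fset0.
Proof.
move=> /fset0Pn[a Aa] /fset0Pn[b Bb].
by apply/fset0Pn; exists (a + b); exact: mem_fsumset.
Qed.

Lemma card_fsumset_le A B : (#|` fsumset A B| <= #|` A| * #|` B|)%N.
Proof.
rewrite /fsumset unlock /= size_seq_fset; apply: leq_trans (size_undup _) _.
by rewrite size_allpairs.
Qed.

End Sumset.

Lemma imfset_fsumset (G H : zmodType) (f : {additive G -> H}) (A B : {fset G}) :
  (f @` fsumset A B = fsumset (f @` A) (f @` B))%fset.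
Proof.
apply/fsetP => y; apply/imfsetP/fsumsetP.
  move=> [_ /fsumsetP[a [b [Aa Bb ->]]] ->]; exists (f a), (f b).
  by rewrite raddfD !in_imfset.
move=> [_ [_ [/imfsetP[a Aa ->] /imfsetP[b Bb ->] ->]]].
by exists (a + b); [exact: mem_fsumset|rewrite raddfD].
Qed.

(** * Trajectories *)

Section Trajectory.
Variables (G : zmodType) (phi : {additive G -> G}).
Implicit Types F : {fset G}.

(** Trajectories are natural in the endomorphism.  The maps [f] of interest are the
    inclusion of an invariant subgroup, the iterates of [phi] and the opposite. *)
Lemma trajectory_equivariant (H : zmodType) (psi : {additive H -> H})
    (f : {additive G -> H}) F n :
  (forall x, f (phi x) = psi (f x)) ->
  trajectory psi (f @` F)%fset n = (f @` trajectory phi F n)%fset.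
Proof.
move=> fphi; rewrite /trajectory.
rewrite (big_morph (fun A => f @` A)%fset (id1 := [fset 0]%fset) (op1 := @fsumset H));
  [|exact: imfset_fsumset|by rewrite imfset_fset1 raddf0].
apply: eq_bigr => i _; rewrite -!imfset_comp; apply: eq_imfset => // x /=.
by elim: (i : nat) => //= k ->.
Qed.

Lemma trajectoryS F F' n :
  (F `<=` F' -> trajectory phi F n `<=` trajectory phi F' n)%fset.
Proof.
move=> sF; rewrite /trajectory; elim/big_rec2: _ => // i A B _ sBA.
by apply: fsumsetS => //; apply: subset_imfset; exact/fsubsetP.
Qed.

Lemma trajectory_neq0 F n : F != fset0 -> trajectory phi F n != fset0.
Proof.
move=> /fset0Pn[x Fx]; rewrite /trajectory.
elim/big_rec: _ => [|i A _ A0]; first by apply/fset0Pn; exists 0; rewrite fset11.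
by apply: fsumset_neq0 => //; apply/fset0Pn; exists (iter i phi x); rewrite in_imfset.
Qed.

Lemma trajectory0 n : trajectory phi [fset 0]%fset n = [fset 0]%fset.
Proof.
rewrite /trajectory big1// => i _; rewrite imfset_fset1; congr [fset _]%fset.
by elim: (i : nat) => //= k ->; rewrite raddf0.
Qed.

Lemma iter_is_zmod_morphism k : zmod_morphism (iter k phi).
Proof. by move=> x y; elim: k => //= k ->; rewrite raddfB. Qed.

HB.instance Definition _ k :=
  GRing.isZmodMorphism.Build G G (iter k phi) (iter_is_zmod_morphism k).

Lemma trajectory_fsumset F F' n :
  trajectory phi (fsumset F F') n
  = fsumset (trajectory phi F n) (trajectory phi F' n).
Proof.
rewrite /trajectory -big_split/=; apply: eq_bigr => i _.
exact: (imfset_fsumset (iter i phi)).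
Qed.

Lemma trajectoryD F m n :
  trajectory phi F (m + n)
  = fsumset (trajectory phi F m) (iter m phi @` trajectory phi F n)%fset.
Proof.
rewrite {1}/trajectory big_split_ord/=; congr fsumset.
rewrite -(@trajectory_equivariant _ phi (iter m phi)); last first.
  by move=> x; exact/esym/iterSr.
apply: eq_bigr => i _; rewrite -imfset_comp; apply: eq_imfset => // x /=.
by rewrite addnC iterD.
Qed.

Lemma card_trajectoryD_le F m n :
  (#|` trajectory phi F (m + n)| <=
   #|` trajectory phi F m| * #|` trajectory phi F n|)%N.
Proof.
rewrite trajectoryD; apply: leq_trans (card_fsumset_le _ _) _.
by rewrite leq_mul2l leq_imfset_card orbT.
Qed.

Lemma card_trajectory_gt0 F n : F != fset0 -> (0 < #|` trajectory phi F n|)%N.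
Proof. by rewrite cardfs_gt0; exact: trajectory_neq0. Qed.

End Trajectory.

(** * Sets of zero growth *)

Section Growth.
Variable R : realType.

Lemma ln_nat_ge0 m : 0 <= ln (m%:R : R).
Proof. by case: m => [|m]; [rewrite ln0|rewrite ln_ge0// ler1n]. Qed.

Lemma ler_ln_nat m n : (0 < m)%N -> (m <= n)%N -> ln (m%:R : R) <= ln n%:R.
Proof.
by move=> m0 mn; rewrite ler_ln ?ler_nat// posrE ltr0n// (leq_trans m0).
Qed.

Lemma ln_natM m n : (0 < m)%N -> (0 < n)%N ->
  ln ((m * n)%:R : R) = ln m%:R + ln n%:R.
Proof. by move=> m0 n0; rewrite natrM lnM// posrE ltr0n. Qed.

Definition growth (G : zmodType) (phi : {additive G -> G}) (F : {fset G})
    (n : nat) : R := ln #|` trajectory phi F n|%:R / n%:R.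

Lemma growth_ge0 (G : zmodType) (phi : {additive G -> G}) F n :
  0 <= growth phi F n.
Proof. by rewrite divr_ge0 ?ln_nat_ge0. Qed.

Lemma cvg_growth (G : zmodType) (phi : {additive G -> G}) F :
  F != fset0 -> cvgn (growth phi F).
Proof.
move=> F0; apply: (cvg_subadditive_quotient
    (a := fun n => ln #|` trajectory phi F n|%:R)) => [n|m n].
  exact: ln_nat_ge0.
rewrite -ln_natM ?card_trajectory_gt0//.
by apply: ler_ln_nat; [exact: card_trajectory_gt0|exact: card_trajectoryD_le].
Qed.

Definition zero_growth (G : zmodType) (phi : {additive G -> G}) (F : {fset G}) :=
  growth phi F @ \oo --> 0.

(** The implication from right to left is where Fekete's lemma is needed: the
    value of the limit determines the behaviour of the sequence only because the
    sequence converges. *)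
Lemma zero_growthP (G : zmodType) (phi : {additive G -> G}) F :
  F != fset0 -> zero_growth phi F <-> entropy_at R phi F = 0.
Proof.
move=> F0; split=> [|phiF0]; first exact: cvg_lim.
by rewrite /zero_growth -phiF0; exact: cvg_growth.
Qed.

Lemma entropy_at_ge0 (G : zmodType) (phi : {additive G -> G}) F :
  F != fset0 -> 0 <= entropy_at R phi F.
Proof.
move=> F0; apply: limr_ge; first exact: cvg_growth.
by apply: nearW => n; exact: growth_ge0.
Qed.

Lemma algebraic_entropy_eq0 (G : zmodType) (phi : {additive G -> G}) :
  algebraic_entropy R phi = 0%E <->
  (forall F : {fset G}, F != fset0 -> zero_growth phi F).
Proof.
split=> [h0 F F0|zg].
  apply/zero_growthP => //; apply/eqP; rewrite eq_le entropy_at_ge0// andbT.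
  by rewrite -lee_fin -[leRHS]h0; apply: ereal_sup_ubound; exists F.
apply/eqP; rewrite eq_le; apply/andP; split.
  apply: ge_ereal_sup => _ [F F0 <-].
  by rewrite lee_fin (zero_growthP _ F0).1//; exact: zg.
apply: ereal_sup_ubound; exists [fset 0]%fset => /=.
  by apply/fset0Pn; exists 0; rewrite fset11.
congr (_%:E); apply/zero_growthP; last apply: zg;
  by apply/fset0Pn; exists 0; rewrite fset11.
Qed.

Lemma zero_growth_le (G H : zmodType) (phi : {additive G -> G})
    (psi : {additive H -> H}) (F : {fset G}) (F' : {fset H}) :
  F != fset0 ->
  (forall n, #|` trajectory phi F n| <= #|` trajectory psi F' n|)%N ->
  zero_growth psi F' -> zero_growth phi F.
Proof.
move=> F0 leF zF'; apply: (@squeeze_cvgr _ _ _ _ (cst 0) (growth psi F')) => //.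
  apply: nearW => n; rewrite growth_ge0/= ler_wpM2r// ler_ln_nat//.
  exact: card_trajectory_gt0.
exact: cvg_cst.
Qed.

Lemma zero_growthS (G : zmodType) (phi : {additive G -> G}) (F F' : {fset G}) :
  F != fset0 -> (F `<=` F')%fset -> zero_growth phi F' -> zero_growth phi F.
Proof.
move=> F0 sF; apply: zero_growth_le => // n.
by apply: fsubset_leq_card; exact: trajectoryS.
Qed.

Lemma zero_growth_equivariant (G H : zmodType) (phi : {additive G -> G})
    (psi : {additive H -> H}) (f : {additive G -> H}) (F : {fset G}) :
  F != fset0 -> (forall x, f (phi x) = psi (f x)) ->
  zero_growth phi F -> zero_growth psi (f @` F)%fset.
Proof.
move=> /fset0Pn[x Fx] fphi; apply: zero_growth_le => [|n].
  by apply/fset0Pn; exists (f x); rewrite in_imfset.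
by rewrite (trajectory_equivariant _ _ fphi) leq_imfset_card.
Qed.

Lemma zero_growth_injective (G H : zmodType) (phi : {additive G -> G})
    (psi : {additive H -> H}) (f : {additive G -> H}) (F : {fset G}) :
  injective f -> F != fset0 -> (forall x, f (phi x) = psi (f x)) ->
  zero_growth psi (f @` F)%fset -> zero_growth phi F.
Proof.
move=> injf F0 fphi; apply: zero_growth_le => // n.
by rewrite (trajectory_equivariant _ _ fphi) card_imfset.
Qed.

Lemma zero_growth_fsumset (G : zmodType) (phi : {additive G -> G})
    (F F' : {fset G}) :
  F != fset0 -> F' != fset0 -> zero_growth phi F -> zero_growth phi F' ->
  zero_growth phi (fsumset F F').
Proof.
move=> F0 F'0 zF zF'.
apply: (@squeeze_cvgr _ _ _ _ (cst 0) (growth phi F \+ growth phi F')).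
- apply: nearW => n; rewrite growth_ge0/= -mulrDl ler_wpM2r//.
  rewrite -ln_natM ?card_trajectory_gt0//; apply: ler_ln_nat.
    by apply: card_trajectory_gt0; exact: fsumset_neq0.
  by rewrite trajectory_fsumset card_fsumset_le.
- exact: cvg_cst.
- by rewrite -[0]addr0; exact: cvgD.
Qed.

Lemma zero_growth0 (G : zmodType) (phi : {additive G -> G}) :
  zero_growth phi [fset 0]%fset.
Proof.
rewrite /zero_growth (_ : growth _ _ = cst 0); first exact: cvg_cst.
by apply/funext => n; rewrite /growth trajectory0 cardfs1 ln1 mul0r.
Qed.

Lemma zero_growth_restriction (G : zmodType) (phi : {additive G -> G})
    (P : zmodClosed G) (invP : invariant_subgroup phi P)
    (F : {fset subgroup_type P}) : F != fset0 ->
  zero_growth (restriction invP) F <-> zero_growth phi (\val @` F)%fset.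
Proof.
move=> F0; pose f : {additive subgroup_type P -> G} := \val.
split; first exact: (zero_growth_equivariant (f := f)).
by apply: (zero_growth_injective (f := f)) => //; exact: val_inj.
Qed.

(** * The Pinsker subgroup *)

Section Pinsker.
Variables (G : zmodType) (phi : {additive G -> G}).

Definition pinsker : {pred G} :=
  [pred x | `[< zero_growth phi [fset 0; x]%fset >]].

Lemma pinskerP x : reflect (zero_growth phi [fset 0; x]%fset) (x \in pinsker).
Proof. exact: asboolP. Qed.

Lemma fset2_neq0 (x y : G) : [fset x; y]%fset != fset0.
Proof. by apply/fset0Pn; exists x; exact: fset21. Qed.

Lemma pinsker_equivariant (f : {additive G -> G}) x :
  (forall y, f (phi y) = phi (f y)) -> x \in pinsker -> f x \in pinsker.
Proof.
move=> fphi /pinskerP/(zero_growth_equivariant (fset2_neq0 _ _) fphi).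
by rewrite imfset_fset2 raddf0 => /pinskerP.
Qed.

Lemma pinsker_zmod_closed : zmod_closed pinsker.
Proof.
split=> [|x y Px Py].
  by apply/pinskerP; rewrite fsetUid; exact: zero_growth0.
have {}Py : - y \in pinsker.
  (* The opposite is an endomorphism commuting with phi. *)
  by apply: (@pinsker_equivariant (-%R)) => // z /=; rewrite raddfN.
apply/pinskerP; have := zero_growth_fsumset (fset2_neq0 _ _) (fset2_neq0 _ _)
  (pinskerP _ Px) (pinskerP _ Py).
apply: zero_growthS; first exact: fset2_neq0.
apply/fsubsetP => z; rewrite !inE => /orP[]/eqP->.
  by apply: mem_fsumsetl; exact: fset21.
by apply: mem_fsumset; exact: fset22.
Qed.

HB.instance Definition _ :=
  GRing.isZmodClosed.Build G pinsker pinsker_zmod_closed.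

Lemma pinsker_invariant : invariant_subgroup phi pinsker.
Proof. by move=> x; exact: pinsker_equivariant. Qed.

(** The covering set is the sum of the pairs [{0, x}], built one element at a time;
    that it contains 0 is what lets it keep the elements already covered when
    a new pair is added. *)
Lemma pinsker_zero_growth (F : {fset G}) :
  F != fset0 -> {subset F <= pinsker} -> zero_growth phi F.
Proof.
move=> F0 FP.
suff cover (s : seq G) : {subset s <= pinsker} -> exists F' : {fset G},
    [/\ {subset s <= F'}, 0 \in F' & zero_growth phi F'].
  have [F' [sF' _ zF']] := cover F FP.
  by apply: zero_growthS zF' => //; exact/fsubsetP.
elim: s => [|x s IHs] sP.
  by exists [fset 0]%fset; split; [|exact: fset11|exact: zero_growth0].
have [y sy|F' [sF' F'0 zF']] := IHs; first by rewrite sP// in_cons sy orbT.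
exists (fsumset [fset 0; x]%fset F'); split.
- move=> y; rewrite in_cons => /predU1P[->|/sF' F'y].
    by apply: mem_fsumsetl => //; exact: fset22.
  by apply: mem_fsumsetr => //; exact: fset21.
- by apply: mem_fsumsetl => //; exact: fset21.
- apply: zero_growth_fsumset => //; first exact: fset2_neq0.
    by apply/fset0Pn; exists 0.
  by apply/pinskerP/sP; rewrite mem_head.
Qed.

End Pinsker.
End Growth.

Theorem proposition3p1 (R : realType) (G : zmodType) (phi : {additive G -> G}) :
  exists P : zmodClosed G, is_pinsker_subgroup R phi P.
Proof.
exists (pinsker R phi : zmodClosed G); split=> [|Q invQ].
  exists (@pinsker_invariant R G phi); apply/algebraic_entropy_eq0 => F F0.
  apply/zero_growth_restriction => //; apply: pinsker_zero_growth.
    by have /fset0Pn[x Fx] := F0; apply/fset0Pn; exists (val x); rewrite in_imfset.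
  by move=> _ /imfsetP[y _ ->]; exact: valP.
move=> /algebraic_entropy_eq0 zQ x Qx; apply/pinskerP.
pose y : subgroup_type Q := Sub x Qx.
have /zero_growth_restriction := zQ _ (fset2_neq0 0 y).
by rewrite imfset_fset2; apply; exact: fset2_neq0.
Qed.
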